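(* Let $K$ be a field, $n\in\mathbb{N}$, $A_n$ the $n$-th Weyl algebra over $K$, $R:=K[x_1,\ldots,x_n]\subsetneq A_n$, $\mathfrak{p}$ a prime ideal of $R$, and $S:=R\setminus\mathfrak{p}$. Let $I$ be a left ideal of $A_n$ with $\{0\}\subsetneq I\subsetneq A_n$, let $m_1,\ldots,m_k\in R$ be generators of the ideal $I\cap R$ of $R$, and for each $1\le i\le k$ let $\tilde m_i$ be the normal form of $m_i$ with respect to $\mathfrak{p}$. Then $I\cap S=\emptyset$ if and only if $\tilde m_i=0$ for all $1\le i\le k$.
   Context: The $n$-th Weyl algebra is $A_n=K\langle x_1,\ldots,x_n,\partial_1,\ldots,\partial_n\rangle$ with relations $\partial_i x_i=x_i\partial_i+1$ for $1\le i\le n$, all other pairs of generators commuting. The normal form of an element $m\in R$ with respect to the ideal $\mathfrak{p}$ is its normal form (remainder) with respect to a Gröbner basis of $\mathfrak{p}$ for a fixed monomial well-ordering on $R$; in particular it is zero if and only if $m\in\mathfrak{p}$. *)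

(* Defs.v *)
From HB Require Import structures.
From mathcomp Require Import all_boot all_order all_algebra.
From mathcomp Require Import boolp.
From mathcomp Require Import finmap.
From mathcomp Require Import -(notations) monalg.
From mathcomp Require Import mpoly.

Set Implicit Arguments.
Unset Strict Implicit.
Unset Printing Implicit Defensive.

Import GRing.Theory.
Import Quotient.

Local Open Scope ring_scope.
Local Open Scope quotient_scope.

(* The Weyl algebra is the quotient of the free (noncommutative) algebra      *)
(* K<x_i, d_i> by the two-sided ideal generated by its defining relations.    *)
(* It is not the ring of operators generated by the x_i and d/dx_i: the two   *)
(* differ in positive characteristic, where (d/dx_i)^p = 0.                   *)

(* The letter inl i stands for x_i and inr i for d_i. *)
Definition weyl_free (K : fieldType) (n : nat) :=
  monalg.malg (fmonom ('I_n + 'I_n)%type) K.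

Section WeylAlgebra.
Variables (K : fieldType) (n : nat).

Local Notation F := (weyl_free K n).

HB.instance Definition _ := GRing.NzRing.on F.

Definition freeX (i : 'I_n) : F := monalg.mkmalgU (fmu (inl i)) 1.
Definition freeD (i : 'I_n) : F := monalg.mkmalgU (fmu (inr i)) 1.

Inductive weyl_relator : F -> Prop :=
| WeylDX i : weyl_relator (freeD i * freeX i - (freeX i * freeD i + 1))
| WeylDXC i j of i != j : weyl_relator (freeD i * freeX j - freeX j * freeD i)
| WeylXXC i j : weyl_relator (freeX i * freeX j - freeX j * freeX i)
| WeylDDC i j : weyl_relator (freeD i * freeD j - freeD j * freeD i).

Inductive in_weyl_ideal : F -> Prop :=
| WeylIdealRel f of weyl_relator f : in_weyl_ideal f
| WeylIdeal0 : in_weyl_ideal 0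
| WeylIdealB f g of in_weyl_ideal f & in_weyl_ideal g : in_weyl_ideal (f - g)
| WeylIdealMl f g of in_weyl_ideal g : in_weyl_ideal (f * g)
| WeylIdealMr f g of in_weyl_ideal f : in_weyl_ideal (f * g).

Definition weyl_ideal : {pred F} := fun f => `[< in_weyl_ideal f >].

Fact weyl_ideal_zmod_closed : zmod_closed weyl_ideal.
Proof.
split=> [|f g /asboolP Jf /asboolP Jg]; apply/asboolP; first exact: WeylIdeal0.
exact: WeylIdealB.
Qed.

HB.instance Definition _ :=
  GRing.isZmodClosed.Build F weyl_ideal weyl_ideal_zmod_closed.

Definition weyl := {quot weyl_ideal}.

HB.instance Definition _ := GRing.Zmodule.on weyl.
HB.instance Definition _ := EqQuotient.on weyl.

Definition weyl_one : weyl := lift_cst weyl 1.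
Definition weyl_mul : weyl -> weyl -> weyl := lift_op2 weyl *%R.

Definition weyl_repr (a : weyl) : F := repr a.

Lemma weyl_reprK (a : weyl) : \pi_weyl (weyl_repr a) = a.
Proof. exact: reprK. Qed.

Lemma weyl_piP (f g : F) :
  \pi_weyl f = \pi_weyl g <-> in_weyl_ideal (f - g).
Proof.
split=> [/eqP|J]; first by rewrite -idealrBE => /asboolP.
by apply/eqP; rewrite -idealrBE; apply/asboolP.
Qed.

Lemma weyl_piM (f g : F) : \pi_weyl (f * g) = weyl_mul (\pi f) (\pi g).
Proof.
rewrite /weyl_mul; unlock; apply/weyl_piP.
rewrite -[f * g](addrNK (f * repr (\pi_weyl g))) -mulrBr -addrA -mulrBl.
rewrite -[X in _ + X]opprK -[_ + - _]/(_ - _); apply: WeylIdealB.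
  by apply: WeylIdealMl; apply/weyl_piP; rewrite reprK.
by rewrite -mulNr opprB; apply: WeylIdealMr; apply/weyl_piP; rewrite reprK.
Qed.

Lemma weyl_piD (f g : F) : \pi_weyl (f + g) = \pi_weyl f + \pi_weyl g.
Proof. by rewrite [LHS](@pi_add _ weyl_ideal). Qed.

(* Action on K[x_1, ..., x_n]; it shows that the quotient is nontrivial and   *)
(* that K[x_1, ..., x_n] embeds into it.                                      *)

Definition weyl_act1 (g : 'I_n + 'I_n) (p : {mpoly K[n]}) : {mpoly K[n]} :=
  match g with inl i => 'X_i * p | inr i => p^`M(i) end.

Definition weyl_actw (w : fmonom ('I_n + 'I_n)%type) (p : {mpoly K[n]}) :=
  foldr weyl_act1 p w.

Definition weyl_act (p : {mpoly K[n]}) (f : F) : {mpoly K[n]} :=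
  monalg.mmap (@mpolyC n K) (weyl_actw^~ p) f.

Lemma weyl_actw_linear w : linear (weyl_actw w).
Proof.
move=> c p q; rewrite /weyl_actw.
elim: (fmonom_val w) => [//|[] i s IHs] /=; rewrite IHs.
  by rewrite mulrDr -scalerAr.
by rewrite mderivD mderivZ.
Qed.

HB.instance Definition _ w :=
  GRing.isLinear.Build K {mpoly K[n]} {mpoly K[n]} _ (weyl_actw w)
    (weyl_actw_linear w).

Lemma weyl_actU p c w :
  weyl_act p (monalg.mkmalgU w c) = c *: weyl_actw w p.
Proof. by rewrite /weyl_act monalg.mmapU mul_mpolyC. Qed.

Lemma weyl_actD p f g : weyl_act p (f + g) = weyl_act p f + weyl_act p g.
Proof. exact: monalg.mmapD. Qed.

Lemma weyl_actN p f : weyl_act p (- f) = - weyl_act p f.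
Proof. exact: monalg.mmapN. Qed.

Lemma weyl_act0 p : weyl_act p 0 = 0.
Proof. exact: monalg.mmap0. Qed.

Lemma weyl_act_sum p (I : Type) (r : seq I) (G : I -> F) :
  weyl_act p (\sum_(i <- r) G i) = \sum_(i <- r) weyl_act p (G i).
Proof. exact: (big_morph _ (weyl_actD p) (weyl_act0 p)). Qed.

Lemma weyl_act1E p : weyl_act p 1 = p.
Proof. by rewrite weyl_actU scale1r /weyl_actw fm1. Qed.

Lemma weyl_actM p f g : weyl_act p (f * g) = weyl_act (weyl_act p g) f.
Proof.
rewrite monalg.malgME weyl_act_sum [RHS]monalg.mmapE; apply: eq_bigr => v _.
rewrite weyl_act_sum mul_mpolyC [weyl_act p g]monalg.mmapE.
rewrite linear_sum scaler_sumr.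
apply: eq_bigr => w _; rewrite weyl_actU mul_mpolyC linearZ_LR scalerA /=.
by rewrite /weyl_actw fmM foldr_cat.
Qed.

Lemma weyl_actX p i : weyl_act p (freeX i) = 'X_i * p.
Proof. by rewrite weyl_actU scale1r /weyl_actw fmU. Qed.

Lemma weyl_actDer p i : weyl_act p (freeD i) = p^`M(i).
Proof. by rewrite weyl_actU scale1r /weyl_actw fmU. Qed.

Lemma weyl_act_ideal p f : in_weyl_ideal f -> weyl_act p f = 0.
Proof.
move=> Jf; elim: Jf p => {f}.
- move=> f [i|i j neq_ij|i j|i j] p;
    rewrite ?(weyl_actD, weyl_actN, weyl_actM, weyl_actX);
    rewrite ?(weyl_actDer, weyl_act1E).
  + rewrite mderivM mderivX mnm1E eqxx scale1r -[X in 'X_[X - _]]add0m addmK.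
    by rewrite mpolyX0 mul1r [X in X - _]addrC subrr.
  + rewrite mderivM mderivX mnm1E eq_sym (negPf neq_ij).
    by rewrite scale0r mul0r add0r subrr.
  + by rewrite mulrCA subrr.
  + by rewrite mderiv_comm subrr.
- exact: weyl_act0.
- by move=> f g _ IHf _ IHg p; rewrite weyl_actD weyl_actN IHf IHg subr0.
- move=> f g _ IHg p.
  by rewrite weyl_actM IHg -(weyl_act0 0) -weyl_actM mulr0 weyl_act0.
- by move=> f g _ IHf p; rewrite weyl_actM IHf.
Qed.

Lemma weyl_mulA : associative weyl_mul.
Proof.
by move=> a b c; rewrite -[a]reprK -[b]reprK -[c]reprK -!weyl_piM mulrA.
Qed.

Lemma weyl_oneE : weyl_one = \pi_weyl 1.
Proof. by rewrite /weyl_one; unlock. Qed.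

Lemma weyl_mul1l : left_id weyl_one weyl_mul.
Proof. by move=> a; rewrite -[a]reprK weyl_oneE -weyl_piM mul1r. Qed.

Lemma weyl_mul1r : right_id weyl_one weyl_mul.
Proof. by move=> a; rewrite -[a]reprK weyl_oneE -weyl_piM mulr1. Qed.

Lemma weyl_mulDl : left_distributive weyl_mul +%R.
Proof.
move=> a b c; rewrite -[a]reprK -[b]reprK -[c]reprK.
by rewrite -weyl_piD -!weyl_piM mulrDl weyl_piD.
Qed.

Lemma weyl_mulDr : right_distributive weyl_mul +%R.
Proof.
move=> a b c; rewrite -[a]reprK -[b]reprK -[c]reprK.
by rewrite -weyl_piD -!weyl_piM mulrDr weyl_piD.
Qed.

Lemma weyl_pi_act p (f g : F) :
  \pi_weyl f = \pi_weyl g -> weyl_act p f = weyl_act p g.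
Proof.
move/weyl_piP/(weyl_act_ideal p); rewrite weyl_actD weyl_actN.
by move/eqP; rewrite subr_eq0 => /eqP.
Qed.

Lemma weyl_pi0 : (0 : weyl) = \pi_weyl 0.
Proof. by apply: (addrI (\pi_weyl 0)); rewrite addr0 -weyl_piD addr0. Qed.

Lemma weyl_one_neq0 : weyl_one != 0.
Proof.
apply/eqP; rewrite weyl_oneE weyl_pi0 => /(weyl_pi_act 1)/eqP.
by rewrite weyl_act1E weyl_act0 oner_eq0.
Qed.

HB.instance Definition _ := GRing.Zmodule_isNzRing.Build weyl
  weyl_mulA weyl_mul1l weyl_mul1r weyl_mulDl weyl_mulDr weyl_one_neq0.

Definition weylC (c : K) : weyl := \pi_weyl (monalg.mkmalgU (fmone _) c : F).
Definition weylX (i : 'I_n) : weyl := \pi_weyl (freeX i).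
Definition weylD (i : 'I_n) : weyl := \pi_weyl (freeD i).

(* The inclusion of R = K[x_1, ..., x_n] into the Weyl algebra. *)
Definition weyl_poly (f : {mpoly K[n]}) : weyl := mmap weylC weylX f.

Lemma weyl_poly_inj : injective weyl_poly.
Proof.
pose ev (a : weyl) := weyl_act 1 (weyl_repr a).
have evpi f : ev (\pi_weyl f) = weyl_act 1 f.
  by apply: weyl_pi_act; rewrite weyl_reprK.
have evD a b : ev (a + b) = ev a + ev b.
  by rewrite -[a]weyl_reprK -[b]weyl_reprK -weyl_piD !evpi weyl_actD.
have ev0 : ev 0 = 0 by rewrite weyl_pi0 evpi weyl_act0.
have actM a b p : weyl_act p (weyl_repr (a * b)) =
    weyl_act (weyl_act p (weyl_repr b)) (weyl_repr a).
  rewrite -weyl_actM; apply: weyl_pi_act.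
  by rewrite weyl_reprK weyl_piM !weyl_reprK.
have act1 p : weyl_act p (weyl_repr (1 : weyl)) = p.
  rewrite -[RHS]weyl_act1E; apply: weyl_pi_act.
  by rewrite weyl_reprK -weyl_oneE.
have actX i e p : weyl_act p (weyl_repr (weylX i ^+ e)) = 'X_i ^+ e * p.
  elim: e => [|e IHe]; first by rewrite !expr0 mul1r act1.
  rewrite !exprS actM IHe -mulrA -weyl_actX; apply: weyl_pi_act.
  by rewrite weyl_reprK.
have actXm m p : weyl_act p (weyl_repr (mmap1 weylX m)) = 'X_[m] * p.
  rewrite mpolyXE_id /mmap1; elim/big_rec2: _ p => [p|i q a _ IHa p].
    by rewrite act1 mul1r.
  by rewrite actM IHa actX mulrA.
suff evK : cancel weyl_poly ev by exact: can_inj evK.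
move=> f; rewrite /weyl_poly /mmap (big_morph ev evD ev0) [RHS]mpolyE.
apply: eq_bigr => m _; rewrite /ev actM actXm mulr1.
rewrite (weyl_pi_act _ (g := monalg.mkmalgU (fmone _) f@_m)) ?weyl_reprK //.
by rewrite weyl_actU /weyl_actw fmoneE.
Qed.
End WeylAlgebra.

Section NormalForm.
Variables (K : fieldType) (n : nat).
Implicit Types (f g r : {mpoly K[n]}) (G : seq {mpoly K[n]}).

Definition monomial_well_order (le : rel 'X_{1..n}) : Prop :=
  [/\ antisymmetric le, transitive le, total le,
      forall m1 m2 m, le m1 m2 -> le (m1 + m)%MM (m2 + m)%MM
    & well_founded (fun m1 m2 => (m1 != m2) && le m1 m2)].

Definition leading_monomial (le : rel 'X_{1..n}) f (m : 'X_{1..n}) : Prop :=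
  m \in msupp f /\ {in msupp f, forall m', le m' m}.

(* On multinomials, (m <= m')%MM is divisibility of monomials. *)
Definition groebner_basis (le : rel 'X_{1..n}) (J : {pred {mpoly K[n]}}) G :
    Prop :=
  {subset G <= J} /\
  forall f, f \in J -> f != 0 ->
    exists g mg mf, [/\ g \in G, leading_monomial le g mg,
      leading_monomial le f mf & (mg <= mf)%MM].

(* r is the remainder of f in the multivariate division by G: f is            *)
(* \sum_i q_i G_i + r with no term of r divisible by a leading monomial of G, *)
(* and with no leading monomial of some q_i G_i above that of f.              *)
Definition normal_form (le : rel 'X_{1..n}) G f r : Prop :=
  exists q : 'I_(size G) -> {mpoly K[n]},
    [/\ f = \sum_i q i * G`_i + r,
        forall i, {in msupp (q i * G`_i), forall m,
          exists2 m', m' \in msupp f & le m m'}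
      & {in msupp r, forall m, forall g mg,
          g \in G -> leading_monomial le g mg -> ~~ (mg <= m)%MM}].

End NormalForm.

Definition left_ideal (A : nzRingType) (I : {pred A}) : Prop :=
  GRing.submod_closed (I : {pred A^o}).

Definition generates_ideal (R : comNzRingType) (k : nat) (m : 'I_k -> R)
    (J : {pred R}) : Prop :=
  forall f, f \in J <-> exists q : 'I_k -> R, f = \sum_i q i * m i.

(* The intersection of I with R = K[x_1, ..., x_n], as a subset of R. *)
Definition poly_part (K : fieldType) (n : nat) (I : {pred weyl K n}) :
    {pred {mpoly K[n]}} :=
  [pred f | weyl_poly f \in I].

(* Main.v *)
Require Import Defs.
From mathcomp Require Import all_boot all_order all_algebra.
From mathcomp Require Import mpoly.

Local Open Scope ring_scope.

Import GRing.Theory.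

(** Disjointness of [I] from the complement of [p] says that the contraction of [I] to the
    polynomial ring lies in [p]. As [p] is an ideal, this can be tested on the generators [m i], and
    [normal_form_eq0] turns each test into the vanishing of a remainder. *)

Lemma idealr_sum_mul (R : comNzRingType) (p : idealr R) (J : finType)
    (q g : J -> R) :
  (forall i, g i \in p) -> \sum_i q i * g i \in p.
Proof. by move=> pg; apply: rpred_sum => i _; apply: idealMr. Qed.

(** [f] and [r] differ by a combination of elements of [G], so they are congruent modulo [p]; and an
    irreducible remainder lying in [p] must vanish. *)
Lemma normal_form_eq0 (K : fieldType) (n : nat) (p : idealr {mpoly K[n]})
    (le : rel 'X_{1..n}) (G : seq {mpoly K[n]}) (f r : {mpoly K[n]}) :
  groebner_basis le p G -> normal_form le G f r -> r = 0 <-> f \in p.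
Proof.
case=> sGp lead_div [q [def_f _ irred_r]].
have p_sum: \sum_(i < size G) q i * G`_i \in p.
  by apply: idealr_sum_mul => i; apply/sGp/mem_nth.
split=> [r0 | pf]; first by rewrite def_f r0 addr0.
have pr: r \in p by rewrite -(rpredDl r p_sum) -def_f.
(* If [r] were nonzero, its leading monomial [mr] would be a term divisible by a leading monomial of
   [G]. *)
apply/eqP/negP => /negP /(lead_div r pr) [g [mg [mr [Gg lt_g [r_mr _] dvd_mr]]]].
by have /negP := irred_r mr r_mr g mg Gg lt_g.
Qed.

Theorem proposition5p9 (K : fieldType) (n : nat)
    (p : prime_idealr {mpoly K[n]})
    (le : rel 'X_{1..n}) (le_order : monomial_well_order le)
    (G : seq {mpoly K[n]}) (G_basis : groebner_basis le p G)
    (I : {pred weyl K n}) (I_ideal : left_ideal I)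
    (I_neq0 : exists2 a, a \in I & a != 0) (I_proper : exists a, a \notin I)
    (k : nat) (m : 'I_k -> {mpoly K[n]})
    (m_gen : generates_ideal m (poly_part I))
    (mt : 'I_k -> {mpoly K[n]})
    (mt_nf : forall i : 'I_k, normal_form le G (m i) (mt i)) :
  (~ exists2 s : {mpoly K[n]}, s \notin p & weyl_poly s \in I) <->
  (forall i : 'I_k, mt i = 0).
Proof.
have nf0 i : mt i = 0 <-> m i \in p :=
    normal_form_eq0 _ _ _ _ _ _ _ G_basis (mt_nf i).
split=> [I_disj i | mt0 [s /negP ps Is]].
  (* A generator outside [p] would itself be a common element; Kronecker delta coefficients show
     that it lies in [I]. *)
  apply/nf0/negPn/negP => pmi; apply: I_disj; exists (m i) => //.
  apply/(m_gen (m i)); exists (fun j => (j == i)%:R).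
  rewrite (bigD1 i) //= eqxx mul1r big1 ?addr0 // => j /negPf ->.
  by rewrite mul0r.
have /(m_gen s) [q def_s] : s \in poly_part I by [].
by apply: ps; rewrite def_s; apply: idealr_sum_mul => i; apply/nf0.
Qed.
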